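(* Let $\mathcal{F}=\{\mathcal{M}_1,\mathcal{M}_2,\dots\}$ be an infinite family of connected graphs, parameterized by a value $n$. Suppose that for every graph $\mathcal{M}_n=(\mathcal{V}_n,\mathcal{E}_n)\in\mathcal{F}$, for $n\ge 2$, the vertex set $\mathcal{V}_n$ can be partitioned into a set $\mathcal{S}_n$ of classes inducing subgraphs of $\mathcal{M}_n$ that satisfy the following conditions: 1. Each subgraph induced by a class is isomorphic to a Cartesian product of one or more graphs $\mathcal{M}_{i_1}\Box\cdots\Box\mathcal{M}_{i_k}$, where each $\mathcal{M}_{i_j}\in\mathcal{F}$ has $i_j<n$. 2. The number of classes is $n^{O(1)}$. 3. For every pair of (distinct) classes $C,C'\in\mathcal{S}_n$, the set of edges between the subgraphs induced by the two classes is a matching of size at least $|C||C'|/|\mathcal{V}_n|$. 4. Given a pair of (distinct) classes $C,C'\in\mathcal{S}_n$, there exist a graph $\mathcal{M}_i$ in the Cartesian product $C$, and a class $U\in\mathcal{S}_i$ within the graph $\mathcal{M}_i$, such that the set of vertices in $C$ having a neighbor in $C'$ is precisely the set of vertices in $C$ whose projection onto $\mathcal{M}_i$ lies in $U$. Furthermore, no class $U$ within $\mathcal{M}_i$ is the projection of more than one such boundary. Suppose further that $|\mathcal{V}_1|=1$. Then the expansion of $\mathcal{M}_n$ is $\Omega\left(1/(\kappa(n)\,n)\right)$, where $\kappa(n)=\max_{1\le i\le n}|\mathcal{S}_i|$ is the maximum number of classes in any $\mathcal{M}_i$, $i\le n$.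
   Context: All graphs are finite; asymptotic constants are uniform in $n$. The one-vertex graph $\mathcal{M}_1$ is regarded as having the trivial partition $\mathcal{S}_1=\{\mathcal{V}_1\}$. The Cartesian product $G\Box H$ has vertex set $V(G)\times V(H)$, with $(u,v)$ adjacent to $(u',v')$ iff ($uu'\in E(G)$ and $v=v'$) or ($u=u'$ and $vv'\in E(H)$); the projection of $(u,v)$ onto $G$ is $u$ and onto $H$ is $v$, and similarly for products of several graphs. For a class $C$, the identification with the product in condition 1 is fixed, and ''a graph $\mathcal{M}_i$ in the Cartesian product $C$'' is one of its factors. The ''boundary'' of $C$ with respect to $C'$ is the set of vertices in $C$ having a neighbor in $C'$; the last sentence of condition 4 says that, for fixed $C$ and a fixed factor $\mathcal{M}_i$ of $C$, different classes $C'$ do not yield the same class $U$ of that factor. The (edge) expansion of a graph $G=(V,E)$ is $h(G)=\min_{S\subseteq V,\,0<|S|\le|V|/2}|\partial S|/|S|$, where $\partial S$ is the set of edges between $S$ and $V\setminus S$. *)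

(* Defs.v *)
From HB Require Import structures.
From mathcomp Require Import all_boot all_order all_algebra.
From mathcomp Require Import constructive_ereal reals.

Set Implicit Arguments.
Unset Strict Implicit.
Unset Printing Implicit Defensive.

Import Order.TTheory GRing.Theory Num.Theory.

Record sgraph := SGraph {
  vertex :> finType;
  edge : rel vertex;
  edge_sym : symmetric edge;
  edge_irrefl : irreflexive edge
}.

Definition connected (G : sgraph) : Prop :=
  0 < #|G| /\ forall x y : G, connect (@edge G) x y.

Section Induced.
Variables (G : sgraph) (C : {set G}).

Definition induced_edge : rel {x : G | x \in C} :=
  fun x y => edge (val x) (val y).

Lemma induced_edge_sym : symmetric induced_edge.
Proof. by move=> x y; exact: edge_sym. Qed.

Lemma induced_edge_irrefl : irreflexive induced_edge.
Proof. by move=> x; exact: edge_irrefl. Qed.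

Definition induced : sgraph := SGraph induced_edge_sym induced_edge_irrefl.

End Induced.

Section CartesianProduct.
Variables (I : finType) (F : I -> sgraph).

Definition cart_edge : rel {dffun forall j : I, F j} :=
  fun x y => [exists j, edge (x j) (y j) &&
                        [forall l, (l != j) ==> (x l == y l)]].

Lemma cart_edge_sym : symmetric cart_edge.
Proof.
move=> x y; apply: eq_existsb => j; rewrite edge_sym; congr (_ && _).
by apply: eq_forallb => l; rewrite [x l == _]eq_sym.
Qed.

Lemma cart_edge_irrefl : irreflexive cart_edge.
Proof. by move=> x; apply/existsP => -[j]; rewrite edge_irrefl. Qed.

Definition cart_prod : sgraph := SGraph cart_edge_sym cart_edge_irrefl.

End CartesianProduct.

Record graph_iso (G H : sgraph) := GraphIso {
  iso_fun :> G -> H;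
  iso_bij : bijective iso_fun;
  iso_edge : forall x y : G, edge (iso_fun x) (iso_fun y) = edge x y
}.

(* Edges are listed as ordered pairs; for disjoint A and B each undirected
   edge between A and B occurs exactly once. *)
Definition edges_between (G : sgraph) (A B : {set G}) : {set G * G} :=
  [set p | [&& p.1 \in A, p.2 \in B & edge p.1 p.2]].

(* To be used on edges_between A B with A and B disjoint: the first endpoint of
   one pair is then never the second endpoint of another. *)
Definition is_matching (G : sgraph) (E : {set G * G}) : Prop :=
  forall p q, p \in E -> q \in E -> p.1 = q.1 \/ p.2 = q.2 -> p = q.

Definition boundary (G : sgraph) (C C' : {set G}) : {set G} :=
  [set x in C | [exists y in C', edge x y]].

(* The minimum over the empty family (one-vertex graph) is +oo. *)
Definition expansion (R : realType) (G : sgraph) : \bar R :=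
  \big[Order.min/+oo%E]_(A : {set G} | (0 < #|A|) && (#|A|.*2 <= #|G|))
    (#|edges_between A (~: A)|%:R / #|A|%:R)%:E.

(* The families are indexed from 1: M 0 is a dummy graph that no definition
   or hypothesis below refers to. *)
Record class_product (M : nat -> sgraph) (n : nat) (C : {set M n}) :=
  ClassProduct {
    arity : nat;
    arity_gt0 : 0 < arity;
    factor : 'I_arity -> nat;
    factor_bound : forall j, 0 < factor j < n;
    class_iso : graph_iso (induced C) (cart_prod (fun j => M (factor j)))
  }.

(* A factor is designated by its position j in the product, since the same
   graph of the family may occur at several positions. *)
Definition factor_subset (M : nat -> sgraph) (n : nat) (C : {set M n})
    (P : class_product C) : Type :=
  {j : 'I_(arity P) & {set M (factor j)}}.

Definition cylinder (M : nat -> sgraph) (n : nat) (C : {set M n})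
    (P : class_product C) (w : factor_subset P) : {set M n} :=
  [set val x | x : {x : M n | x \in C} & class_iso P x (tag w) \in tagged w].

(* The map w selects, for each class C' other than C, one position and one
   class of the factor at that position describing the boundary of C with
   respect to C'.  Distinctness is required of the selected pairs, not of the
   boundaries: a boundary equal to all of C can be described at several
   positions, and different C' may have the same boundary provided that they
   are assigned different positions. *)
Definition boundary_classes (M : nat -> sgraph) (S : forall n, {set {set M n}})
    (n : nat) (C : {set M n}) (P : class_product C) : Prop :=
  exists w : {set M n} -> factor_subset P,
    (forall C', C' \in S n -> C' != C ->
       tagged (w C') \in S (factor (tag (w C'))) /\
       boundary C C' = cylinder (w C')) /\
    (forall C' C'', C' \in S n -> C' != C -> C'' \in S n -> C'' != C ->
       w C' = w C'' -> C' = C'').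

Definition kappa (M : nat -> sgraph) (S : forall n, {set {set M n}})
    (n : nat) : nat :=
  \max_(1 <= i < n.+1) #|S i|.

(* Main.v *)
Require Import Defs.
From HB Require Import structures.
From mathcomp Require Import all_boot all_order all_algebra.
From mathcomp Require Import constructive_ereal reals.
From mathcomp Require Import ring lra.

Import Order.TTheory GRing.Theory Num.Theory.

(** The proof bounds the expansion of [M n] below by [1 / (2 * n)], which
    suffices because [kappa Sc n >= 1].  It works with inequalities for all
    real functions [f] on the vertices rather than with flows or cuts:
    [variation f] sums [|f x - f y|] over ordered edges, and two kinds of
    deviation from the mean of [f] are compared with it.

    The key inequality ([block_poincare]) compares class averages with the
    global average: the sum over the classes [U] of
    [|\sum_(x in U) (f x - mean f)|] is at most [variation f], with constant 1
    for every member of the family, so that nothing is lost in the recursion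
    ([block_poincare_step]).  Let [eps C] be the sign of the deviation of [C].
    Up to normalisation, the left-hand side is a sum over pairs of classes of
    [(eps C - eps C') * (average on C - average on C')], and each difference of
    averages splits into a step from [C] to its boundary with [C'], a step
    across the matching, and a step from the other boundary to [C'].  The size
    of the matching makes the crossing steps cost at most the variation along
    the edges between classes.  Inside [C], whose boundary with [C'] is a
    cylinder over a block of one factor, the step towards [C'] is the deviation
    of that block, summed over the fibres, with coefficient
    [t * (eps C' - eps C)] for some [t] in [[0, 1]].  The deviations of all
    blocks of a factor add up to [0], and distinct [C'] select distinct blocks,
    so [eps C] may be added to all coefficients, which brings them into
    [[-1, 1]] ([sum_selected_le]).  The constant 2, which would be compounded
    at each level of the recursion, thereby becomes 1, and the induction
    hypothesis for the factors bounds these steps by the variation inside [C].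

    The second inequality ([l1_poincare]) compares vertices with the global
    average.  Its constant for a Cartesian product is the largest constant of
    the factors ([cart_prod_l1_poincare]).  Inside every class it therefore
    holds with the constant obtained for the smaller graphs, and passing from
    the class averages to the global average costs one more [variation f] by
    the key inequality ([l1_poincare_step]).  So [M n] has constant [n].  For
    the indicator function of [A] the variation is twice the number of edges
    leaving [A], and the bound on the expansion follows. *)

(** * Finite sums *)

Section FiniteSums.
Local Open Scope ring_scope.
Context {R : realFieldType}.

(** As the [delta u] cancel over [D], subtracting [e] from the coefficient of
    every [u] in [D] does not change the sum.  The shifted coefficients are at
    most [1] in absolute value: those of selected indices because [theta] is
    within [1] of [e], and the others, which become [- e], because
    [`|e| <= 1]. *)
Lemma sum_selected_le (X J : finType) (A : {pred X}) (D : {pred J})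
    (h : X -> J) (theta : X -> R) (delta : J -> R) (e : R) :
  {in A &, injective h} -> {in A, forall x, h x \in D} ->
  `|e| <= 1 -> {in A, forall x, `|theta x - e| <= 1} ->
  \sum_(u in D) delta u = 0 ->
  \sum_(x in A) theta x * delta (h x) <= \sum_(u in D) `|delta u|.
Proof.
move=> hinj hD e1 theta1 d0.
have split_D (F : J -> R) : \sum_(u in D) F u =
    \sum_(x in A) F (h x) + \sum_(u in D | u \notin h @: A) F u.
  rewrite (bigID (mem (h @: A))) /= -(big_imset F hinj); congr (_ + _).
  apply: eq_bigl => u; apply: andb_idl => /imsetP[x xA ->]; exact: hD.
have -> : \sum_(x in A) theta x * delta (h x) =
    \sum_(x in A) (theta x - e) * delta (h x)
      - e * \sum_(u in D | u \notin h @: A) delta u.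
  move/eqP: d0; rewrite split_D addr_eq0 => /eqP d0.
  rewrite -[in RHS]mulrN -d0 mulr_sumr -big_split /=.
  by apply: eq_bigr => x _; ring.
rewrite split_D; apply: lerD.
  apply: ler_sum => x xA; apply: le_trans (ler_norm _) _.
  by rewrite normrM ler_piMl // theta1.
apply: le_trans (ler_norm _) _; rewrite normrN normrM.
apply: le_trans (ler_norm_sum _ _ _).
by rewrite ler_piMl.
Qed.

Lemma sum_offdiag_swap (T : finType) (S : {set T}) (X : T -> T -> R) :
  \sum_(C in S) \sum_(C' in S | C' != C) X C C' =
  \sum_(C in S) \sum_(C' in S | C' != C) X C' C.
Proof.
rewrite (exchange_big_dep (mem S)) /=; last by move=> C C' _ /andP[].
apply: eq_bigr => C CS; apply: eq_bigl => C'.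
by rewrite [C \in S]CS /= eq_sym.
Qed.

End FiniteSums.

(** * Means, variation and L1 Poincare inequalities *)

Section Means.
Local Open Scope ring_scope.
Context {R : realFieldType}.

Definition mean {T : finType} (f : T -> R) : R := (\sum_x f x) / #|T|%:R.

Definition set_mean {G : sgraph} (A : {set G}) (f : G -> R) : R :=
  (\sum_(x in A) f x) / #|A|%:R.

(** Every undirected edge is counted twice, once in each direction. *)
Definition variation {G : sgraph} (f : G -> R) : R :=
  \sum_x \sum_(y | edge x y) `|f x - f y|.

Definition cross_variation {G : sgraph} (A B : {set G}) (f : G -> R) : R :=
  \sum_(x in A) \sum_(y in B | edge x y) `|f x - f y|.

Definition l1_poincare (G : sgraph) (a : R) : Prop :=
  forall f : G -> R, \sum_x `|f x - mean f| <= a * variation f.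

Definition block_poincare (G : sgraph) (S : {set {set G}}) : Prop :=
  forall f : G -> R,
    \sum_(U in S) `|\sum_(x in U) (f x - mean f)| <= variation f.

Lemma partition_block_gt0 {T : finType} {S : {set {set T}}} {D C : {set T}} :
  partition S D -> C \in S -> (0 : R) < #|C|%:R.
Proof.
move=> pS CS; rewrite ltr0n card_gt0; apply: contraTneq CS => ->.
by case/and3P: pS.
Qed.

Lemma variation_ge0 (G : sgraph) (f : G -> R) : 0 <= variation f.
Proof. by apply: sumr_ge0 => x _; apply: sumr_ge0. Qed.

Lemma cross_variation_ge0 (G : sgraph) (A B : {set G}) (f : G -> R) :
  0 <= cross_variation A B f.
Proof. by apply: sumr_ge0 => x _; apply: sumr_ge0. Qed.

Lemma sum_mean (T : finType) (f : T -> R) :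
  (0 < #|T|)%N -> \sum_x f x = #|T|%:R * mean f.
Proof.
by move=> T0; rewrite /mean mulrCA mulfV ?mulr1 // pnatr_eq0 -lt0n.
Qed.

Lemma sum_deviation (T : finType) (f : T -> R) : \sum_x (f x - mean f) = 0.
Proof.
have [T0|] := posnP #|T|.
  by rewrite big_pred0 // => x; have := card0_eq T0 x.
by move=> T0; rewrite sumrB sumr_const sum_mean // mulr_natl subrr.
Qed.

Lemma cross_variation_partition (G : sgraph) (S : {set {set G}})
    (f : G -> R) : partition S [set: G] ->
  variation f = \sum_(C in S) \sum_(C' in S) cross_variation C C' f.
Proof.
move=> pS; rewrite /variation.
transitivity (\sum_(x in [set: G]) \sum_(y | edge x y) `|f x - f y|).
  by apply: eq_bigl => x; rewrite inE.
rewrite (set_partition_big _ pS) /=; apply: eq_bigr => C _.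
rewrite exchange_big; apply: eq_bigr => x _ /=.
transitivity (\sum_(y in [set: G] | edge x y) `|f x - f y|).
  by apply: eq_bigl => y; rewrite inE.
by rewrite (set_partition_big_cond _ pS).
Qed.

End Means.

(** * Cartesian products *)

Section Product.
Local Open Scope ring_scope.
Context {R : realFieldType} (I : finType) (F : I -> sgraph).
Hypothesis F_gt0 : forall j, (0 < #|F j|)%N.
Local Notation H := (cart_prod F).

Definition upd (x : H) (j : I) (a : F j) : H := [ffun l => dfwith x a l].

Lemma upd_same x j a : upd x j a j = a.
Proof. by rewrite ffunE dfwith_in. Qed.

Lemma upd_other x j a l : l != j -> upd x j a l = x l.
Proof. by move=> lj; rewrite ffunE dfwith_out // eq_sym. Qed.

Lemma upd_upd x j a b : upd (upd x j a) j b = upd x j b.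
Proof.
apply/ffunP => l; have [->|lj] := eqVneq l j; first by rewrite !upd_same.
by rewrite !upd_other.
Qed.

Lemma upd_id x j : upd x j (x j) = x.
Proof.
apply/ffunP => l; have [->|lj] := eqVneq l j; first by rewrite !upd_same.
by rewrite !upd_other.
Qed.

(** The map exchanging the [j]-th coordinate of [x] with [a] is an involution
    of the pairs [(x, a)]. *)
Lemma sum_upd j (phi : H -> R) :
  \sum_x \sum_a phi (upd x j a) = #|F j|%:R * \sum_x phi x.
Proof.
rewrite pair_bigA /=.
pose sw (p : H * F j) := (upd p.1 j p.2, p.1 j).
have swK : involutive sw by case=> x a; rewrite /sw /= upd_upd upd_id upd_same.
rewrite (reindex_inj (inv_inj swK)) /=.
under eq_bigr => p _ do rewrite upd_upd upd_id.
rewrite -(pair_bigA _ (fun x (_ : F j) => phi x)) /= mulr_sumr.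
by apply: eq_bigr => x _; rewrite sumr_const mulr_natl.
Qed.

(** The part of the variation carried by the edges parallel to [F j]. *)
Definition dir_variation (j : I) (f : H -> R) : R :=
  \sum_(x : H) \sum_(a | edge (x j) a) `|f x - f (upd x j a)|.

Lemma sum_dir_variation (f : H -> R) :
  \sum_j dir_variation j f <= variation f.
Proof.
rewrite /dir_variation exchange_big; apply: ler_sum => x _ /=.
pose P j (y : H) := edge (x j) (y j) && [forall l, (l != j) ==> (x l == y l)].
have upd_reindex j : \sum_(a | edge (x j) a) `|f x - f (upd x j a)| =
    \sum_(y | P j y) `|f x - f y|.
  rewrite [RHS](reindex_onto (upd x j) (fun y : H => y j)) /=; last first.
    move=> y /andP[_ /forallP xy]; apply/ffunP => l.
    have [->|lj] := eqVneq l j; first by rewrite upd_same.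
    by rewrite upd_other //; apply/eqP/(implyP (xy l)).
  apply: eq_bigl => a; rewrite /P upd_same eqxx andbT andb_idr //.
  by move=> _; apply/forallP => l; apply/implyP => lj; rewrite upd_other.
under eq_bigr => j _ do rewrite upd_reindex.
rewrite (exchange_big_dep (fun y => edge x y)) /=; last first.
  by move=> j y _ Pjy; apply/existsP; exists j.
apply: ler_sum => y /existsP[j Pjy].
rewrite (big_pred1 j) // => l /=; apply/idP/eqP => [/andP[exy _]|-> //].
case/andP: Pjy => _ /forallP/(_ l); case: eqVneq => //= _ /eqP xyl.
by rewrite xyl edge_irrefl in exy.
Qed.

Lemma sum_variation_upd j (f : H -> R) :
  \sum_x variation (fun a => f (upd x j a)) = #|F j|%:R * dir_variation j f.
Proof.
rewrite -sum_upd; apply: eq_bigr => x _; rewrite /variation.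
apply: eq_bigr => a _; rewrite upd_same.
by apply: eq_bigr => b _; rewrite upd_upd.
Qed.

Definition average (j : I) (f : H -> R) : H -> R :=
  fun x => mean (fun a => f (upd x j a)).

Lemma natr_F_gt0 j : (0 : R) < #|F j|%:R.
Proof. by rewrite ltr0n. Qed.

Lemma sum_average j (f : H -> R) : \sum_x average j f x = \sum_x f x.
Proof.
rewrite /average /mean -mulr_suml sum_upd mulrAC mulfV ?mul1r //.
by rewrite gt_eqF // natr_F_gt0.
Qed.

Lemma sum_norm_average j (f : H -> R) :
  \sum_x `|average j f x| <= \sum_x `|f x|.
Proof.
rewrite -(sum_average j (fun x => `|f x|)); apply: ler_sum => x _.
rewrite /average /mean normrM normfV normr_nat ler_wpM2r ?invr_ge0 //.
exact: ler_norm_sum.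
Qed.

Lemma averageB j (f g : H -> R) x :
  average j (fun y => f y - g y) x = average j f x - average j g x.
Proof. by rewrite /average /mean sumrB mulrBl. Qed.

Lemma average_deviation j (a : R) (f : H -> R) : l1_poincare (F j) a ->
  \sum_x `|f x - average j f x| <= a * dir_variation j f.
Proof.
move=> Fa; rewrite -(ler_pM2l (natr_F_gt0 j)) -sum_upd mulrCA.
rewrite -sum_variation_upd mulr_sumr; apply: ler_sum => x _.
apply: le_trans (Fa _); rewrite le_eqVlt; apply/orP; left; apply/eqP.
apply: eq_bigr => b _; congr `|_ - _|; rewrite /average /mean.
by under eq_bigr => c _ do rewrite upd_upd.
Qed.

(** Telescoping: averaging does not increase the L1 norm, so averaging along
    one more direction [j] adds at most the deviation of [f] along [j]. *)
Lemma average_seq_deviation (s : seq I) (a : R) (f : H -> R) :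
  (forall j, l1_poincare (F j) a) ->
  \sum_x `|f x - foldr average f s x| <= a * \sum_(j <- s) dir_variation j f.
Proof.
move=> Fa; elim: s => [|j s IHs] /=.
  by rewrite big_nil mulr0; under eq_bigr do rewrite subrr normr0; rewrite big1.
rewrite big_cons mulrDr.
apply: le_trans (lerD (average_deviation j a f (Fa j)) IHs).
rewrite -(lerD2l (- \sum_x `|f x - foldr average f s x|)).
rewrite [leRHS]addrC addrK addrC lerBlDl.
apply: le_trans (lerD (sum_norm_average j (fun y => f y - foldr average f s y))
  (lexx _)).
rewrite -big_split /=; apply: ler_sum => x _; rewrite averageB.
rewrite [leRHS]addrC; apply: le_trans (ler_normD _ _).
by rewrite addrA subrK.
Qed.

(** Averaging along all directions thus gives a constant, necessarily the
    mean. *)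
Lemma average_seq_const (s : seq I) (f : H -> R) (x y : H) :
  (forall l, l \notin s -> x l = y l) -> foldr average f s x = foldr average f s y.
Proof.
elim: s x y => [|j s IHs] x y xy /=.
  by congr f; apply/ffunP => l; apply: xy.
rewrite /average /mean; congr (_ / _); apply: eq_bigr => a _.
apply: IHs => l ls; have [->|lj] := eqVneq l j; first by rewrite !upd_same.
by rewrite !upd_other // xy // inE negb_or lj.
Qed.

Lemma sum_average_seq (s : seq I) (f : H -> R) :
  \sum_x foldr average f s x = \sum_x f x.
Proof. by elim: s => //= j s <-; rewrite sum_average. Qed.

(** No constant is lost because the edge set of the product is the disjoint
    union of its directions, and each direction pays only for the average taken
    along it. *)
Lemma cart_prod_l1_poincare (a : R) : 0 <= a ->
  (forall j, l1_poincare (F j) a) -> l1_poincare H a.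
Proof.
move=> a0 Fa f.
apply: le_trans (ler_wpM2l a0 (sum_dir_variation f)).
rewrite -[in leRHS]big_enum; apply: le_trans (average_seq_deviation _ _ _ Fa).
apply: ler_sum => x _; set T := foldr _ _ _.
rewrite le_eqVlt; apply/orP; left; apply/eqP; congr `|_ - _|.
have H0 : (0 < #|H|)%N by apply/card_gt0P; exists x.
rewrite /mean -(sum_average_seq (enum I)) -/T.
rewrite (eq_bigr (fun=> T x)); last first.
  by move=> y _; apply: average_seq_const => l; rewrite mem_enum.
by rewrite sumr_const -[_ *+ #|_|]mulr_natr mulfK // pnatr_eq0 -lt0n.
Qed.

Lemma cylinder_deviation (j : I) (U : {set F j}) (f : H -> R) :
  #|F j|%:R * \sum_(x : H | x j \in U) (f x - mean f) =
  \sum_x \sum_(a in U) (f (upd x j a) - average j f x).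
Proof.
rewrite big_mkcond -sum_upd /=.
under eq_bigr => x _ do under eq_bigr => a _ do rewrite upd_same.
under eq_bigr => x _ do rewrite -big_mkcond sumrB /= sumr_const -mulr_natl.
under [RHS]eq_bigr => x _ do rewrite sumrB /= sumr_const -mulr_natl.
rewrite !sumrB; congr (_ - _); rewrite -mulr_sumr -[RHS]mulr_sumr sum_average; congr (_ * _).
by apply/eqP; rewrite eq_sym -subr_eq0 -sumrB sum_deviation.
Qed.

(** The deviation of a cylinder is the sum of the deviations of its base over
    the fibres parallel to [F j], where the hypothesis on [F j] applies. *)
Lemma dir_block_poincare (j : I) (S : {set {set F j}}) (f : H -> R) :
  block_poincare (R := R) (F j) S ->
  \sum_(U in S) `|\sum_(x : H | x j \in U) (f x - mean f)|
    <= dir_variation j f.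
Proof.
move=> Sj; rewrite -(ler_pM2l (natr_F_gt0 j)) -sum_variation_upd mulr_sumr.
under eq_bigr => U _.
  rewrite -[#|_|%:R]normr_nat -normrM cylinder_deviation; over.
apply: le_trans (_ : \sum_(U in S) \sum_x
    `|\sum_(a in U) (f (upd x j a) - average j f x)| <= _).
  by apply: ler_sum => U _; apply: ler_norm_sum.
by rewrite exchange_big; apply: ler_sum => x _; apply: Sj.
Qed.

End Product.

Section ProductBlocks.
Local Open Scope ring_scope.
Context {R : realFieldType}.

(** Blocks of all factors are handled together: the deviations of the
    cylinders over the blocks of a given factor cancel, hence so do those of
    all cylinders, as [sum_selected_le] requires. *)
Lemma cylinders_le_variation (I : finType) (F : I -> sgraph)
    (S : forall j, {set {set F j}}) (g : cart_prod F -> R) (X : finType)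
    (A : {pred X}) (w : X -> {j : I & {set F j}}) (theta : X -> R) (e : R) :
  (forall j, (0 < #|F j|)%N) ->
  (forall j, partition (S j) [set: F j]) ->
  (forall j, block_poincare (R := R) (F j) (S j)) ->
  {in A &, injective w} -> {in A, forall x, tagged (w x) \in S (tag (w x))} ->
  `|e| <= 1 -> {in A, forall x, `|theta x - e| <= 1} ->
  \sum_(x in A) theta x * \sum_(z : cart_prod F |
      z (tag (w x)) \in tagged (w x)) (g z - mean g) <= variation g.
Proof.
move=> F0 pS bS w_inj wS e1 theta1.
pose D := [pred u : {j : I & {set F j}} | tagged u \in S (tag u)].
pose delta (u : {j : I & {set F j}}) :=
  \sum_(z : cart_prod F | z (tag u) \in tagged u) (g z - mean g).
have sumD (k : R -> R) : \sum_(u in D) k (delta u) =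
    \sum_j \sum_(U in S j)
       k (\sum_(z : cart_prod F | z j \in U) (g z - mean g)).
  by rewrite sig_big_dep /=.
apply: (le_trans (y := \sum_(u in D) `|delta u|)).
  apply: (@sum_selected_le R X _ A D w theta delta e) => //.
  rewrite (sumD id) big1 // => j _ /=.
  rewrite -[RHS](sum_deviation _ g).
  rewrite [RHS](partition_big (fun z : cart_prod F => pblock (S j) (z j))
    (mem (S j))) /=; last first.
    by move=> z _; rewrite pblock_mem // (cover_partition (pS j)) inE.
  apply: eq_bigr => U US; apply: eq_bigl => z.
  case/and3P: (pS j) => covS tS _.
  apply/idP/eqP => [zU|<-]; first exact: def_pblock tS US zU.
  by rewrite mem_pblock (eqP covS) inE.
rewrite sumD; apply: le_trans (sum_dir_variation _ _ g).
by apply: ler_sum => j _; apply: dir_block_poincare.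
Qed.

End ProductBlocks.

(** * Boundaries and the recursion for class averages *)

Section Matching.
Local Open Scope ring_scope.
Context {R : realFieldType} {G : sgraph}.

Lemma matching_sum_fst (A B : {set G}) (k : G -> R) :
  is_matching (edges_between A B) ->
  \sum_(x in boundary A B) k x = \sum_(p in edges_between A B) k p.1.
Proof.
move=> mAB; rewrite -(big_imset k (h := fst)) /=; last first.
  by move=> p q pE qE pq; apply: mAB => //; left.
apply: eq_bigl => x; apply/idP/imsetP.
  rewrite inE => /andP[xA /existsP[y /andP[yB exy]]].
  by exists (x, y) => //; rewrite inE /= xA yB.
case=> -[u v] + ->; rewrite !inE /= => /and3P[-> vB euv].
by apply/existsP; exists v; rewrite vB.
Qed.

Lemma matching_sum_snd (A B : {set G}) (k : G -> R) :
  is_matching (edges_between A B) ->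
  \sum_(x in boundary B A) k x = \sum_(p in edges_between A B) k p.2.
Proof.
move=> mAB; rewrite -(big_imset k (h := snd)) /=; last first.
  by move=> p q pE qE pq; apply: mAB => //; right.
apply: eq_bigl => x; apply/idP/imsetP.
  rewrite inE => /andP[xB /existsP[y /andP[yA exy]]].
  by exists (y, x) => //; rewrite inE /= xB yA edge_sym.
case=> -[u v] + ->; rewrite !inE /= => /and3P[uA -> euv].
by apply/existsP; exists u; rewrite uA edge_sym.
Qed.

Lemma cross_variation_edges (A B : {set G}) (f : G -> R) :
  cross_variation A B f = \sum_(p in edges_between A B) `|f p.1 - f p.2|.
Proof.
rewrite /cross_variation pair_big_dep /=.
by apply: eq_bigl => p; rewrite inE.
Qed.

Lemma matching_boundary_diff (A B : {set G}) (f : G -> R) :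
  is_matching (edges_between A B) ->
  `|\sum_(x in boundary A B) f x - \sum_(x in boundary B A) f x|
    <= cross_variation A B f.
Proof.
move=> mAB; rewrite matching_sum_fst // matching_sum_snd // -sumrB.
by rewrite cross_variation_edges; apply: ler_norm_sum.
Qed.

Lemma matching_card_boundary (A B : {set G}) :
  is_matching (edges_between A B) ->
  #|boundary A B|%:R = #|edges_between A B|%:R :> R /\
  #|boundary B A|%:R = #|edges_between A B|%:R :> R.
Proof.
move=> mAB; have c1 (T : finType) (E : {set T}) : #|E|%:R = \sum_(x in E) (1 : R).
  by rewrite sumr_const.
by rewrite !c1 (matching_sum_fst _ _ (fun=> 1)) // (matching_sum_snd _ _ (fun=> 1)).
Qed.

(** The last hypothesis concerns the steps inside a single class; it is used
    with [e := - eps C], where [eps C] is the sign of the deviation of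
    [C]. *)
Lemma block_poincare_step (S : {set {set G}}) :
  partition S [set: G] ->
  {in S &, forall C C', C != C' -> is_matching (edges_between C C') /\
     (#|C| * #|C'|)%:R / #|G|%:R <= #|edges_between C C'|%:R :> R} ->
  (forall (f : G -> R) C (theta : {set G} -> R) (e : R), C \in S ->
     `|e| <= 1 -> {in S, forall C', C' != C -> `|theta C' - e| <= 1} ->
     \sum_(C' in S | C' != C)
        theta C' * \sum_(x in boundary C C') (f x - set_mean C f)
     <= cross_variation C C f) ->
  block_poincare (R := R) G S.
Proof.
move=> pS hM hC f.
pose s (A : {set G}) := \sum_(x in A) f x.
pose N : R := #|G|%:R.
pose beta (C C' : {set G}) :=
  \sum_(x in boundary C C') (f x - set_mean C f).
pose b (C C' : {set G}) : R := #|boundary C C'|%:R.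
(* at most 1, by the lower bound on the size of the matching *)
pose t (C C' : {set G}) : R := #|C|%:R * #|C'|%:R / N / b C C'.
pose eps (C : {set G}) := Num.sg (\sum_(x in C) (f x - mean f)).
have S_gt0 C : C \in S -> (0 : R) < #|C|%:R := partition_block_gt0 pS.
have N_gt0 C : C \in S -> 0 < N.
  move=> CS; apply: lt_le_trans (S_gt0 C CS) _.
  by rewrite ler_nat max_card.
have eps1 C : `|eps C| <= 1 by rewrite normr_sg lern1 leq_b1.
have bE C C' : C \in S -> C' \in S -> C' != C ->
    [/\ 0 < b C C', #|C|%:R * #|C'|%:R / N <= b C C' & b C' C = b C C'].
  rewrite eq_sym => CS C'S /(hM _ _ CS C'S)[mCC' w_le].
  have [bCC' bC'C] := matching_card_boundary C C' mCC'.
  rewrite /b bCC' bC'C -natrM; split=> //; apply: lt_le_trans w_le.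
  by rewrite divr_gt0 ?(N_gt0 C) // natrM mulr_gt0 ?S_gt0.
have t_sym C C' : C \in S -> C' \in S -> C' != C -> t C' C = t C C'.
  move=> CS C'S CC'; have [_ _ bC] := bE _ _ CS C'S CC'.
  by rewrite /t bC [#|C'|%:R * _]mulrC.
have t01 C C' : C \in S -> C' \in S -> C' != C -> 0 <= t C C' <= 1.
  move=> CS C'S CC'; have [b0 w_le _] := bE _ _ CS C'S CC'.
  rewrite /t ler_pdivrMr // mul1r w_le andbT.
  by rewrite !divr_ge0 ?mulr_ge0 ?ler0n // ltW.
(* from C to its boundary, across the matching, and from there to C' *)
have dev_pair C C' : C \in S -> C' \in S -> C' != C ->
    (#|C'|%:R * s C - #|C|%:R * s C') / N =
    t C C' * beta C' C - t C C' * beta C C' +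
    t C C' * (s (boundary C C') - s (boundary C' C)).
  move=> CS C'S CC'; have [b0 _ bC] := bE _ _ CS C'S CC'.
  have betaE (A B : {set G}) : beta A B = s (boundary A B) - b A B * set_mean A f.
    by rewrite /beta sumrB sumr_const -mulr_natl.
  rewrite !betaE bC /t /set_mean -/(s C) -/(s C').
  have N0 := N_gt0 _ CS; have C0 := S_gt0 _ CS; have C'0 := S_gt0 _ C'S.
  by field; rewrite !gt_eqF.
have dev_sum C : C \in S -> \sum_(x in C) (f x - mean f) =
    \sum_(C' in S | C' != C) (#|C'|%:R * s C - #|C|%:R * s C') / N.
  move=> CS; have N0 := N_gt0 _ CS.
  transitivity (\sum_(C' in S) (#|C'|%:R * s C - #|C|%:R * s C') / N).
    rewrite -mulr_suml [in RHS]sumrB -[X in (X - _) / _]mulr_suml.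
    rewrite -[X in (_ - X) / _]mulr_sumr /s -(set_partition_big _ pS).
    rewrite -natr_sum -(card_partition pS) cardsT -/N.
    rewrite sumrB sumr_const -[mean f *+ _]mulr_natl mulrBl mulrAC mulfV ?gt_eqF // mul1r.
    rewrite -mulrA; congr (_ - _ * (_ / _)).
    by apply: eq_bigl => x; rewrite inE.
  rewrite (bigD1 C) //= [X in X + _](_ : _ = 0) ?add0r //.
  by rewrite subrr mul0r.
under eq_bigr => C CS.
  rewrite normrEsg -/(eps C) dev_sum // mulr_sumr.
  under eq_bigr => C' /andP[C'S CC'].
    rewrite dev_pair // mulrDr mulrBr -addrA [- _ + _]addrC addrA.
    over.
  rewrite /= sumrB big_split /=.
  over.
rewrite /= sumrB big_split /=.
(* gather at C all the terms that involve deviations inside C *)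
rewrite [X in X + _ - _]sum_offdiag_swap.
rewrite addrAC -sumrB (cross_variation_partition _ _ f pS).
under [leRHS]eq_bigr => C CS do rewrite (bigD1 C) //=.
rewrite [leRHS]big_split /=; apply: lerD.
  apply: ler_sum => C CS; rewrite -sumrB.
  under eq_bigr => C' /andP[C'S CC'].
    rewrite (t_sym C C') // [eps C' * _]mulrA [eps C * _]mulrA -!mulrBl.
    over.
  apply: (hC f C _ (- eps C)) => //; first by rewrite normrN.
  move=> C' C'S CC'; rewrite opprK.
  have /andP[t0 t1] := t01 _ _ CS C'S CC'.
  (* a convex combination of two signs *)
  rewrite (_ : _ + _ = t C C' * eps C' + (1 - t C C') * eps C); last by ring.
  apply: le_trans (ler_normD _ _) _; rewrite [`|_ * eps C'|]normrM [`|_ * eps C|]normrM.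
  rewrite (ger0_norm t0) [`|1 - _|]ger0_norm ?subr_ge0 //.
  rewrite -[leRHS](subrKC (t C C')); apply: lerD; rewrite ler_piMr ?subr_ge0 //.
apply: ler_sum => C CS; apply: ler_sum => C' /andP[C'S CC'].
have nCC' : C != C' by rewrite eq_sym.
have [mCC' _] := hM _ _ CS C'S nCC'.
apply: le_trans (matching_boundary_diff _ _ f mCC').
apply: le_trans (ler_norm _) _; rewrite mulrA normrM ler_piMl //.
have /andP[t0 t1] := t01 _ _ CS C'S CC'.
by rewrite normrM mulr_ile1 // ger0_norm.
Qed.

End Matching.

(** * Transfer along the isomorphism of a class with a product *)

Section Transfer.
Local Open Scope ring_scope.
Context {R : realFieldType} {G H : sgraph} {C : {set G}}.
Variable phi : graph_iso (induced C) H.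

Lemma sum_transfer (Q : pred H) (k : G -> R) (k' : H -> R) :
  (forall x, k' (phi x) = k (val x)) ->
  \sum_(x in [set val x | x : {x : G | x \in C} & Q (phi x)]) k x =
  \sum_(z | Q z) k' z.
Proof.
move=> kk'; rewrite big_imset /=; last by move=> x y _ _; apply: val_inj.
rewrite [RHS](reindex phi) /=; last exact: onW_bij (iso_bij phi).
by apply: eq_big => x => [|_]; rewrite ?inE ?kk'.
Qed.

Lemma class_as_image : [set val x | x : {x : G | x \in C} & predT (phi x)] = C.
Proof.
apply/setP => x; apply/imsetP/idP => [[u _ ->]|xC]; first exact: valP.
by exists (exist _ x xC).
Qed.

Lemma sum_class_transfer (k : G -> R) (k' : H -> R) :
  (forall x, k' (phi x) = k (val x)) -> \sum_(x in C) k x = \sum_z k' z.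
Proof. by move/(sum_transfer predT) <-; rewrite class_as_image. Qed.

Lemma card_class : #|C| = #|H|.
Proof.
rewrite -(bij_eq_card (iso_bij phi)) card_sig.
by apply: eq_card.
Qed.

Lemma transfer_exists (f : G -> R) :
  exists g : H -> R, forall x, g (phi x) = f (val x).
Proof.
have [psi phiK _] := iso_bij phi.
by exists (fun z => f (val (psi z))) => x; rewrite phiK.
Qed.

Lemma mean_transfer (f : G -> R) (g : H -> R) :
  (forall x, g (phi x) = f (val x)) -> mean g = set_mean C f.
Proof.
by move=> gf; rewrite /mean /set_mean card_class (sum_class_transfer _ _ gf).
Qed.

Lemma variation_transfer (f : G -> R) (g : H -> R) :
  (forall x, g (phi x) = f (val x)) -> cross_variation C C f = variation g.
Proof.
move=> gf; apply: sum_class_transfer => x.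
rewrite big_mkcondr [LHS]big_mkcond /=; apply/esym/sum_class_transfer => y.
by rewrite iso_edge !gf.
Qed.

End Transfer.

(** * The recursion for vertices, and cuts *)

Section Recursion.
Local Open Scope ring_scope.
Context {R : realFieldType}.

(** The triangle inequality through the mean of the class of each vertex; the
    second leg is the block deviation. *)
Lemma l1_poincare_step (G : sgraph) (S : {set {set G}}) (a : R) :
  partition S [set: G] -> block_poincare (R := R) G S -> 0 <= a ->
  (forall (f : G -> R) C, C \in S ->
     \sum_(x in C) `|f x - set_mean C f| <= a * cross_variation C C f) ->
  l1_poincare G (a + 1).
Proof.
move=> pS bS a0 hC f.
have sumS (k : G -> R) : \sum_x k x = \sum_(C in S) \sum_(x in C) k x.
  rewrite -(set_partition_big _ pS).
  by apply: eq_bigl => x; rewrite inE.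
rewrite sumS mulrDl mul1r.
apply: le_trans (lerD (_ : \sum_(C in S) \sum_(x in C) `|f x - set_mean C f|
  <= _) (bS f)).
  rewrite -big_split /=; apply: ler_sum => C CS.
  have C0 : (0 : R) < #|C|%:R := partition_block_gt0 pS CS.
  have -> : \sum_(x in C) (f x - mean f) =
      \sum_(x in C) (set_mean C f - mean f).
    rewrite !sumrB; congr (_ - _).
    by rewrite sumr_const -[RHS]mulr_natr divfK ?gt_eqF.
  rewrite sumr_const normrMn -[X in _ <= _ + X]sumr_const -big_split /=.
  apply: ler_sum => x _; apply: le_trans (ler_normD _ _).
  by rewrite addrA subrK.
rewrite (cross_variation_partition _ _ f pS) mulr_sumr.
apply: ler_sum => C CS; apply: le_trans (hC f C CS) _.
rewrite ler_wpM2l // (bigD1 C) //= lerDl.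
by apply: sumr_ge0 => C' _; apply: cross_variation_ge0.
Qed.

Lemma l1_poincare_le (G : sgraph) (a a' : R) :
  a <= a' -> l1_poincare G a -> l1_poincare G a'.
Proof.
move=> aa' Ga f; apply: le_trans (Ga f) _.
by rewrite ler_wpM2r // variation_ge0.
Qed.

(** For the indicator function of [A], the total deviation is
    [2 * #|A| * (#|G| - #|A|) / #|G|], which is at least [#|A|]. *)
Lemma l1_poincare_edge_boundary (G : sgraph) (a : R) (A : {set G}) :
  l1_poincare G a -> (#|A|.*2 <= #|G|)%N ->
  #|A|%:R <= a * (2 * #|edges_between A (~: A)|%:R).
Proof.
move=> Ga A2; have [G0|G0] := posnP #|G|.
  have -> : A = set0 by apply/setP => x; have := card0_eq G0 x.
  have -> : edges_between set0 (~: (set0 : {set G})) = set0.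
    by apply/setP => p; rewrite !inE.
  by rewrite !cards0 !mulr0.
pose f x : R := (x \in A)%:R.
have fE : variation f = 2 * #|edges_between A (~: A)|%:R.
  have -> : #|edges_between A (~: A)|%:R =
      \sum_x \sum_(y | edge x y) ((x \in A) && (y \notin A))%:R :> R.
    rewrite pair_big_dep /= -natr_sum -big_mkcondr sum1_card.
    congr (_%:R); apply: eq_card => p; rewrite !inE.
    by rewrite [RHS]andbC andbA.
  rewrite mulr2n mulrDl mul1r.
  rewrite [X in _ = _ + X](exchange_big_dep xpredT) //= -big_split /=.
  apply: eq_bigr => x _.
  rewrite [X in _ = _ + X](eq_bigl (edge x)); last by move=> y; rewrite edge_sym.
  rewrite -big_split /=; apply: eq_bigr => y _; rewrite /f.
  by do 2 case: (_ \in A); rewrite /= ?subrr ?subr0 ?sub0r ?normrN ?normr0 ?normr1 ?addr0 ?add0r.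
rewrite -fE; apply: le_trans (Ga f).
have mE : mean f * #|G|%:R = #|A|%:R.
  rewrite /mean divfK ?pnatr_eq0 -?lt0n // -natr_sum.
  by rewrite -big_mkcond sum1_card.
have m0 : 0 <= mean f by rewrite divr_ge0 ?sumr_ge0 // => x _; rewrite ler0n.
rewrite (bigID (mem A)) /=.
apply: (le_trans (y := \sum_(x in A) (1 - mean f) + \sum_(x in ~: A) mean f)).
  rewrite !sumr_const -[_ *+ #|A|]mulr_natl -[_ *+ #|~: A|]mulr_natl.
  have -> : #|~: A|%:R = #|G|%:R - #|A|%:R :> R.
    by rewrite -(cardsC A) natrD addrC addKr.
  have A2R : 0 <= #|G|%:R - #|A|%:R * 2 :> R.
    by rewrite subr_ge0 -natrM ler_nat muln2.
  by have := mulr_ge0 m0 A2R; lra.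
apply: lerD.
  by apply: ler_sum => x xA; apply: le_trans (ler_norm _); rewrite /f xA.
rewrite [leLHS](eq_bigl [pred x | x \notin A]); last by move=> x; rewrite !inE.
apply: ler_sum => x /negbTE xA.
by rewrite /f xA sub0r normrN ger0_norm.
Qed.

End Recursion.

(** * Families of graphs *)

Section Family.
Local Open Scope ring_scope.
Context {R : realFieldType} (M : nat -> sgraph) (Sc : forall n, {set {set M n}}).

(** The boundaries of [C] are cylinders over distinct blocks of the factors, to
    which [cylinders_le_variation] applies. *)
Lemma class_boundary_estimate (n : nat) (C : {set M n}) (P : class_product C) :
  (forall i, (0 < i < n)%N -> (0 < #|M i|)%N) ->
  (forall i, (0 < i < n)%N -> partition (Sc i) [set: M i]) ->
  (forall i, (0 < i < n)%N -> block_poincare (R := R) (M i) (Sc i)) ->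
  boundary_classes Sc P ->
  forall (f : M n -> R) (theta : {set M n} -> R) (e : R), `|e| <= 1 ->
  {in Sc n, forall C', C' != C -> `|theta C' - e| <= 1} ->
  \sum_(C' in Sc n | C' != C)
     theta C' * \sum_(x in boundary C C') (f x - set_mean C f)
  <= cross_variation C C f.
Proof.
move=> M0 pS bS [w [wE w_inj]] f theta e e1 theta1.
have [g gf] := transfer_exists (class_iso P) f.
rewrite (variation_transfer _ _ _ gf).
pose A := [pred C' | (C' \in Sc n) && (C' != C)].
have bound (j : 'I_(arity P)) := factor_bound j.
apply: le_trans (@cylinders_le_variation R _ (fun j => M (factor (c := P) j))
  (fun j => Sc (factor (c := P) j)) g _ A w theta e _ _ _ _ _ e1 _).
- rewrite le_eqVlt; apply/orP; left; apply/eqP; apply: eq_bigr => C' /andP[C'S CC'].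
  congr (_ * _); have [_ ->] := wE _ C'S CC'.
  by apply: sum_transfer => x; rewrite gf (mean_transfer _ _ _ gf).
- by move=> j; apply: M0.
- by move=> j; apply: pS.
- by move=> j; apply: bS.
- by move=> C1 C2 /andP[? ?] /andP[? ?]; apply: w_inj.
- by move=> C' /andP[C'S CC']; have [] := wE _ C'S CC'.
- by move=> C' /andP[C'S CC']; apply: theta1.
Qed.

Lemma class_l1_poincare (n : nat) (C : {set M n}) (P : class_product C) (a : R) :
  0 <= a -> (forall i, (0 < i < n)%N -> (0 < #|M i|)%N) ->
  (forall i, (0 < i < n)%N -> l1_poincare (M i) a) ->
  forall f : M n -> R,
  \sum_(x in C) `|f x - set_mean C f| <= a * cross_variation C C f.
Proof.
move=> a0 M0 Ma f; have [g gf] := transfer_exists (class_iso P) f.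
rewrite (variation_transfer _ _ _ gf) -(mean_transfer _ _ _ gf).
have bound (j : 'I_(arity P)) := factor_bound j.
rewrite (sum_class_transfer (class_iso P) _ (fun z => `|g z - mean g|)).
  by apply: cart_prod_l1_poincare => // j; [apply: M0 | apply: Ma].
by move=> x; rewrite gf.
Qed.

End Family.

Theorem lemma19 (R : realType) (M : nat -> sgraph)
  (Sc : forall n, {set {set M n}})
  (Mconn : forall n, 0 < n -> connected (M n))
  (Spart : forall n, 0 < n -> partition (Sc n) [set: M n])
  (P : forall (n : nat) (C : {set M n}),
     1 < n -> C \in Sc n -> class_product C)
  (Spoly : exists d : nat, forall n, 1 < n -> #|Sc n| <= n ^ d)
  (Smatch : forall (n : nat) (C C' : {set M n}),
     1 < n -> C \in Sc n -> C' \in Sc n -> C != C' ->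
     is_matching (edges_between C C') /\
     ((#|C| * #|C'|)%:R / #|M n|%:R <= #|edges_between C C'|%:R :> R)%R)
  (Sbound : forall (n : nat) (C : {set M n}) (n_gt1 : 1 < n) (CS : C \in Sc n),
     boundary_classes Sc (P n C n_gt1 CS))
  (M1 : #|M 1| = 1)
  (S1 : Sc 1 = [set [set: M 1]]) :
  exists c : R, (0 < c)%R /\
    forall n, 0 < n ->
      ((c / (kappa Sc n * n)%:R)%:E <= expansion R (M n))%E.
Proof.
have M_gt0 i : 0 < i -> 0 < #|M i| by move=> /Mconn[].
have Mblock n : 0 < n -> block_poincare (R := R) (M n) (Sc n).
  elim/ltn_ind: n => n IHn n0.
  have [n1|n1] := leqP n 1.
    have -> : n = 1 by apply/eqP; rewrite eqn_leq n1.
    move=> f; rewrite S1 big_set1.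
    rewrite (eq_bigl xpredT); last by move=> x; rewrite inE.
    by rewrite sum_deviation normr0 variation_ge0.
  apply: block_poincare_step (Spart n n0) _ _.
    by move=> C C' CS C'S; apply: Smatch.
  move=> f C theta e CS; apply: class_boundary_estimate (Sbound n C n1 CS) _ _ _.
  - by move=> i /andP[i0 _]; apply: M_gt0.
  - by move=> i /andP[i0 _]; apply: Spart.
  - by move=> i /andP[i0 lt_in]; apply: IHn.
have Ml1 n : 0 < n -> l1_poincare (M n) (n%:R : R)%R.
  elim/ltn_ind: n => -[//|n] IHn _.
  have [->|n0] := posnP n.
    move=> f; rewrite big1 ?mul1r ?variation_ge0 // => x _.
    have /eqP/fintype1P[y yE] := M1.
    rewrite /mean M1 divr1 (big_pred1 y); last by move=> z; rewrite [z]yE /= eqxx.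
    by rewrite [x]yE subrr normr0.
  rewrite -natr1.
  apply: l1_poincare_step (Spart _ _) (Mblock _ _) _ _ => //.
  move=> f C CS; apply: class_l1_poincare (P n.+1 C n0 CS) _ _ _ _ _.
  - exact: ler0n.
  - by move=> i /andP[i0 _]; apply: M_gt0.
  - move=> i /andP[i0 lt_in]; apply: l1_poincare_le (IHn i lt_in i0).
    by rewrite ler_nat -ltnS.
exists (2^-1)%R; split; first by rewrite invr_gt0 ltr0n.
move=> n n0; apply: le_bigmin => [|A /andP[A0 A2]]; first exact: leey.
rewrite lee_fin ler_pdivlMr ?ltr0n //.
have := l1_poincare_edge_boundary _ _ _ (Ml1 n n0) A2.
set a := (#|A|%:R)%R; set b := (#|edges_between _ _|%:R)%R => ab.
have k1 : 0 < kappa Sc n.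
  rewrite /kappa (big_cat_nat (n := 2)) //= big_nat1 S1 cards1.
  by rewrite leq_max.
have kn : (n%:R <= (kappa Sc n * n)%:R :> R)%R by rewrite ler_nat leq_pmull.
have abK : (a <= (kappa Sc n * n)%:R * (2 * b))%R.
  by apply: le_trans ab _; rewrite ler_wpM2r // mulr_ge0 ?ler0n.
rewrite -invfM mulrC ler_pdivrMr ?mulr_gt0 ?ltr0n ?muln_gt0 ?k1 //.
by rewrite [leRHS]mulrCA [(b * _)%R]mulrC mulrCA.
Qed.
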